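(* Suppose that: (i) for each $(\pi,V)\in\mathbb{S}\times\mathbb{R}^d$ there exists a unique Nash minimizer $P(\pi,V)$ of $e(\pi,\cdot,V)$; (ii) for each $1\le i\le d$, $e_i:\mathbb{S}\times\mathbb{S}^d\times\mathbb{R}^d\to\mathbb{R}$ is continuous. Let $N\ge 1$ be an integer. Then for any initial probability vector $\tilde\pi\in\mathbb{S}$ and terminal cost $\tilde V\in\mathbb{R}^d$ there exists a solution $\{(\pi^n,V^n): 0\le n\le N\}$ to the initial-terminal value problem for the mean field game with $\pi^0=\tilde\pi$ and $V^N=\tilde V$.
   Context: Let $d>1$ be an integer and $\mathbb{S}=\{(q_1,\dots,q_d): q_j\ge 0\ \forall j,\ \sum_{j=1}^d q_j=1\}$. The set of $d\times d$ (row-)stochastic (transition) matrices is identified with $\mathbb{S}^d$. Given transition costs $c_{ij}(\pi,P)$, $1\le i,j\le d$ (functions of $\pi\in\mathbb{S}$, $P\in\mathbb{S}^d$), define $e_i(\pi,P,V)=\sum_j \left(c_{ij}(\pi,P)P_{ij}+V_jP_{ij}\right)$ for $V\in\mathbb{R}^d$. For $P\in\mathbb{S}^d$, $q\in\mathbb{S}$, $\mathcal{P}(P,q,i)$ is the stochastic matrix obtained from $P$ by replacing its $i$-th row by $q$. A matrix $P\in\mathbb{S}^d$ is a Nash minimizer of $e(\pi,\cdot,V)$ if for each $i$ and any $q\in\mathbb{S}$, $e_i(\pi,P,V)\le e_i(\pi,\mathcal{P}(P,q,i),V)$. When a unique Nash minimizer $P(\pi,V)$ exists for all $(\pi,V)$,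 define $\mathcal{G}_\pi(V)_i=e_i(\pi,P(\pi,V),V)$ and $\mathcal{K}_V(\pi)=\pi P(\pi,V)$ (row vector times matrix). A sequence $\{(\pi^n,V^n): 0\le n\le N\}$ in $\mathbb{S}\times\mathbb{R}^d$ is a solution of the mean field game if $V^n=\mathcal{G}_{\pi^n}(V^{n+1})$ and $\pi^{n+1}=\mathcal{K}_{V^{n+1}}(\pi^n)$ for every $0\le n\le N-1$. *)

(* Defs.v *)
From HB Require Import structures.
From mathcomp Require Import all_boot all_order all_algebra.
From mathcomp Require Import all_classical all_reals all_analysis.

Set Implicit Arguments.
Unset Strict Implicit.
Unset Printing Implicit Defensive.

Import Order.TTheory GRing.Theory Num.Theory.
Import numFieldNormedType.Exports.

Local Open Scope classical_set_scope.
Local Open Scope ring_scope.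

Definition simplex (R : realType) (d : nat) : set 'rV[R]_d :=
  [set q | (forall j, 0 <= q 0 j) /\ \sum_j q 0 j = 1].

Definition stochastic (R : realType) (d : nat) : set 'M[R]_d :=
  [set P | forall i, simplex (row i P)].

(* The costs are total functions; every use below is at a point of the simplex
   and a stochastic matrix, so values elsewhere are irrelevant. *)
Definition transition_costs (R : realType) (d : nat) : Type :=
  'I_d -> 'I_d -> 'rV[R]_d -> 'M[R]_d -> R.

Definition expected_cost (R : realType) (d : nat) (c : transition_costs R d)
    (i : 'I_d) (p : 'rV[R]_d) (P : 'M[R]_d) (V : 'cV[R]_d) : R :=
  \sum_j (c i j p P * P i j + V j 0 * P i j).

Definition replace_row (R : realType) (d : nat) (P : 'M[R]_d) (q : 'rV[R]_d)
    (i : 'I_d) : 'M[R]_d :=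
  \matrix_(k, j) (if k == i then q 0 j else P k j).

Definition nash_minimizer (R : realType) (d : nat) (c : transition_costs R d)
    (p : 'rV[R]_d) (V : 'cV[R]_d) : set 'M[R]_d :=
  [set P | stochastic P /\
    forall (i : 'I_d) (q : 'rV[R]_d), simplex q ->
      expected_cost c i p P V <= expected_cost c i p (replace_row P q i) V].

(* The Nash minimizer when it exists and is unique; if there is none, the
   zero matrix. *)
Definition the_nash_minimizer (R : realType) (d : nat)
    (c : transition_costs R d) (p : 'rV[R]_d) (V : 'cV[R]_d) : 'M[R]_d :=
  xget 0 (nash_minimizer c p V).

Definition value_step (R : realType) (d : nat) (c : transition_costs R d)
    (p : 'rV[R]_d) (V : 'cV[R]_d) : 'cV[R]_d :=
  \col_i expected_cost c i p (the_nash_minimizer c p V) V.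

Definition distribution_step (R : realType) (d : nat)
    (c : transition_costs R d) (V : 'cV[R]_d) (p : 'rV[R]_d) : 'rV[R]_d :=
  p *m the_nash_minimizer c p V.

(* The sequences are indexed by all of nat, but only the terms of index at most
   N are constrained. *)
Definition mfg_solution (R : realType) (d : nat) (c : transition_costs R d)
    (N : nat) (p : nat -> 'rV[R]_d) (V : nat -> 'cV[R]_d) : Prop :=
  (forall n, (n <= N)%N -> simplex (p n)) /\
  (forall n, (n < N)%N ->
     V n = value_step c (p n) (V n.+1) /\
     p n.+1 = distribution_step c (V n.+1) (p n)).

(* Main.v *)
(** The two steps of the game turn a family of distributions at times 1, ..., N
    into another one: run the value recursion backwards from the terminal cost
    along the given distributions, then move each distribution one step with the
    resulting minimizers.  Its fixed points are the solutions.  Uniqueness of the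
    Nash minimizer and compactness of the stochastic matrices make the minimizer
    continuous (its graph is closed), so the map is continuous, and Brouwer's
    theorem applies after embedding the N distributions, scaled by 1/N, as a
    retract of one large simplex.

    Brouwer's theorem for the simplex is obtained from a combinatorial lemma of
    Scarf.  Given injective utilities [u i] on a finite set of points and any
    colouring of the points by the indices, there are a set [T] of points and a
    set [C] of indices, all of them colours of points of [T], such that no point
    beats the [u i]-minimum of [T] for every [i] in [C].  The proof is the parity
    argument of Sperner's lemma: "rooms" are the dominant sets of as many
    elements as there are indices, "doors" those with one element less, and
    nearly all doors lie in exactly two rooms.  On a fine grid of the simplex,
    with the coordinates as utilities and the colour of [x] an index [i] with
    [x i <= f x i], such a [T] is a small cell around an approximate fixed
    point; no boundary condition on the colouring is needed. *)

From mathcomp Require Import all_boot zify.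

Set Implicit Arguments.
Unset Strict Implicit.
Unset Printing Implicit Defensive.

(** * Dominant sets and Scarf's lemma *)

Section DominantSets.
Variables (I Y : finType) (u : I -> Y -> nat).
Hypothesis u_inj : forall i, injective (u i).

Definition dominant (S : {set Y}) : bool :=
  [forall y, [exists i, [forall s in S, u i y <= u i s]]].

(** Adjoining such a point to [S] leaves the minima of all indices other than [j] unchanged, so it
    can only become the new minimum for [j]. *)
Definition above (S : {set Y}) (j : I) : {set Y} :=
  [set z | [forall i, (i != j) ==> [exists s in S, u i s < u i z]]].

Lemma dominantP (S : {set Y}) :
  reflect (forall y, exists i, forall s, s \in S -> u i y <= u i s)
          (dominant S).
Proof.
apply: (iffP forallP) => h y.
  by have /existsP[i /forall_inP hi] := h y; exists i.
by have [i hi] := h y; apply/existsP; exists i; apply/forall_inP.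
Qed.

Lemma aboveP (S : {set Y}) (j : I) (z : Y) :
  reflect (forall i, i != j -> exists2 s, s \in S & u i s < u i z)
          (z \in above S j).
Proof.
rewrite inE; apply: (iffP forall_inP) => h i hi.
  by have /exists_inP := h i hi.
by apply/exists_inP; apply: h.
Qed.

Lemma dominantS (S T : {set Y}) : S \subset T -> dominant T -> dominant S.
Proof.
move=> /subsetP ST /dominantP h; apply/dominantP => y.
by have [i hi] := h y; exists i => s /ST; apply: hi.
Qed.

Lemma mins_exist (S : {set Y}) : S != set0 ->
  exists m : {ffun I -> Y}, forall i,
    m i \in S /\ forall s, s \in S -> u i (m i) <= u i s.
Proof.
case/set0Pn=> s0 s0S; exists [ffun i => [arg min_(s < s0 in S) u i s]] => i.
by rewrite ffunE; case: arg_minnP => // s sS h; split.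
Qed.

(* Dominance makes every element of [S] a [u i]-minimum for some [i]; since [I]
   has one more element than [S], exactly one pair [j, k] shares a minimum. *)
Lemma door_mins (S : {set Y}) : S != set0 -> dominant S -> #|S|.+1 = #|I| ->
  exists (m : {ffun I -> Y}) (j k : I),
    [/\ j != k, m j = m k,
        forall i, m i \in S /\ forall s, s \in S -> u i (m i) <= u i s,
        forall i, i != j -> forall l, l != j -> m i = m l -> i = l &
        forall i, i != k -> forall l, l != k -> m i = m l -> i = l].
Proof.
move=> S0 domS cardS.
have [m hm] := mins_exist S0.
have mE (i : I) s : s \in S -> (forall s', s' \in S -> u i s <= u i s') -> m i = s.
  move=> sS h; apply: (u_inj (i := i)); apply/eqP.
  by rewrite eqn_leq (hm i).2 // h // (hm i).1.
have imm : m @: setT = S.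
  apply/setP => s; apply/imsetP/idP => [[i _ ->]|sS]; first exact: (hm i).1.
  by have /dominantP/(_ s)[i hi] := domS; exists i => //; rewrite (mE i s).
have /injectivePn [j [k jk mjk]] : ~~ injectiveb m.
  apply/negP => /injectiveP minj.
  by move: cardS; rewrite -imm card_imset // cardsT => /eqP; rewrite eqn_leq ltnn.
(* Dropping [a] from the indices loses no minimum, since [b] has the same one; the remaining [#|S|]
   indices still map onto [S], hence injectively. *)
have inj_off a b : a != b -> m a = m b ->
    forall i, i != a -> forall l, l != a -> m i = m l -> i = l.
  move=> ab mab i ia l la mil.
  have /imset_injP inj : #|m @: [set~ a]| == #|[set~ a]|.
    rewrite cardsC1 -cardS /= -imm.
    apply/eqP/eq_card => y; apply/imsetP/imsetP => -[x _ ->]; first by exists x.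
    case: (eqVneq x a) => [->|xa]; last by exists x; rewrite ?inE.
    by exists b; rewrite ?inE // eq_sym.
  by apply: inj; rewrite ?inE.
exists m, j, k; split => //; first exact: inj_off jk mjk.
by apply: (inj_off k j); rewrite // eq_sym.
Qed.

(* The rooms containing a door: the added point is the best one for [j] (or for
   [k]) among those above all the other minima. *)
Lemma door_rooms (S : {set Y}) :
  S != set0 -> dominant S -> #|S|.+1 = #|I| ->
  exists j k : I, [disjoint above S j & above S k] /\
    forall y, (y \notin S) && dominant (y |: S) =
      [exists i in [set j; k],
         (y \in above S i) && [forall z in above S i, u i z <= u i y]].
Proof.
move=> S0 domS cardS.
have [m [j [k [jk mjk hm injj injk]]]] := door_mins S0 domS cardS.
exists j, k.
have kj : k != j by rewrite eq_sym.
have lt_m i y : y \notin S -> u i (m i) <= u i y -> u i (m i) < u i y.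
  move=> yS; rewrite leq_eqVlt => /orP[/eqP/u_inj e|//].
  by move: yS; rewrite -e (hm i).1.
have aboveE a z : (z \in above S a) = [forall i, (i != a) ==> (u i (m i) < u i z)].
  apply/aboveP/forall_inP => h i ia.
    by have [s sS] := h i ia; apply: leq_ltn_trans; apply: (hm i).2.
  by exists (m i); [exact: (hm i).1|exact: h].
(* The index witnessing dominance of [S] at [y] can only be [a], so [y] is at most the minimum for
   [a]; it is not [m a] itself, which is also the minimum for [b]. *)
have inS a b y : a != b -> m a = m b -> y \in above S a ->
    (y \notin S) && (u a y < u a (m a)).
  move=> ab mab; rewrite aboveE => /forall_inP h.
  have /dominantP/(_ y)[i hi] := domS.
  have ia : i = a.
    apply/eqP/negPn/negP => ia; have := h i ia.
    by rewrite ltnNge hi // (hm i).1.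
  rewrite {i}ia in hi.
  have yS : y \notin S.
    apply/negP => yS; have e : y = m a.
      by apply: (u_inj (i := a)); apply/eqP; rewrite eqn_leq hi ?(hm a).1 // (hm a).2.
    by have := h b; rewrite e mab ltnn eq_sym => /(_ ab).
  rewrite yS ltn_neqAle hi ?(hm a).1 // andbT.
  by apply: contraNneq yS => /u_inj ->; exact: (hm a).1.
split.
  apply/pred0P => y /=; apply/negP => /andP[yj yk].
  have /andP[_ h1] := inS j k y jk mjk yj.
  have := yk; rewrite aboveE => /forall_inP /(_ j jk).
  by rewrite ltnNge ltnW.
have room a b y : a != b -> m a = m b -> y \in above S a ->
    (forall z, z \in above S a -> u a z <= u a y) -> (y \notin S) && dominant (y |: S).
  move=> ab mab ya ymax; have /andP[yS ylt] := inS a b y ab mab ya.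
  rewrite yS /=; apply/dominantP => z.
  case: (boolP (z \in above S a)) => [za|].
    exists a => s; rewrite !inE => /orP[/eqP->|sS]; first exact: ymax.
    by rewrite (leq_trans (ymax _ za)) // (leq_trans (ltnW ylt)) // (hm a).2.
  rewrite aboveE negb_forall => /existsP[i]; rewrite negb_imply -leqNgt.
  case/andP=> ia zi; exists i => s; rewrite !inE => /orP[/eqP->|sS].
    move: ya; rewrite aboveE => /forall_inP/(_ i ia)/ltnW.
    exact: leq_trans.
  by rewrite (leq_trans zi) // (hm i).2.
move=> y; apply/idP/exists_inP; last first.
  case=> i; rewrite in_set2 => /orP[]/eqP-> /andP[ya /forall_inP ymax].
    exact: room jk mjk ya ymax.
  exact: room kj (esym mjk) ya ymax.
case/andP=> yS domy.
(* Dominance of [y |: S] at the point [m x] keeps it minimal for some index [l], one at which [y]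
   does not undercut. *)
have lowm (x : I) : exists l, u l (m x) <= u l y /\ m l = m x.
  have /dominantP/(_ (m x))[l hl] := domy; exists l; split.
    by apply: hl; rewrite !inE eqxx.
  apply: (u_inj (i := l)); apply/eqP; rewrite eqn_leq (hm l).2 ?(hm x).1 //=.
  by apply: hl; rewrite !inE (hm l).1 orbT.
have low_jk i : u i y < u i (m i) -> i \in [set j; k].
  move=> iy; have [l [ly ml]] := lowm i.
  have li : l != i by apply: contraTneq iy => <-; rewrite -leqNgt ml.
  rewrite !inE; apply/negPn/negP; rewrite negb_or => /andP[ij ik].
  have [lj|lj] := eqVneq l j.
    have lk : l != k by rewrite lj.
    by move/eqP: li; apply; apply: injk.
  by move/eqP: li; apply; apply: injj.
have [i hi] : exists i, u i y < u i (m i).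
  have /dominantP/(_ y)[i hi] := domy; exists i.
  rewrite ltn_neqAle hi ?inE ?(hm i).1 ?orbT // andbT.
  by apply: contraNneq yS => /u_inj ->; exact: (hm i).1.
have ijk := low_jk i hi; exists i => //.
(* If [y] undercut the minima for both [j] and [k], their shared point would stay minimal for no
   index. *)
have uniq_low l : l != i -> u l (m l) < u l y.
  move=> li; rewrite ltnNge; apply/negP => ll.
  have {}ll : u l y < u l (m l).
    rewrite ltn_neqAle ll andbT.
    by apply: contraNneq yS => /u_inj ->; exact: (hm l).1.
  have ljk := low_jk l ll.
  have [x [xy mx]] := lowm j.
  have [h1 h2] : u j y < u j (m j) /\ u k y < u k (m k).
    by move: ijk ljk hi ll li; rewrite !inE => /orP[]/eqP-> /orP[]/eqP->;
      rewrite ?eqxx.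
  have xj : x != j by apply: contraTneq h1 => <-; rewrite -leqNgt mx.
  have xk : x = k by apply: injj => //; rewrite mx.
  by move: h2; rewrite ltnNge -xk mx xy.
apply/andP; split.
  by rewrite aboveE; apply/forall_inP.
(* A candidate better than [y] for [i] would beat every minimum of [y |: S]. *)
apply/forall_inP => z; rewrite aboveE => /forall_inP za.
rewrite leqNgt; apply/negP => yz.
have /dominantP/(_ z)[l hl] := domy.
have [li|li] := eqVneq l i.
  by have := hl y; rewrite !inE eqxx li leqNgt yz => /(_ isT).
have := hl (m l); rewrite !inE (hm l).1 orbT => /(_ isT).
by rewrite leqNgt za.
Qed.

Lemma card_argmax (A : {set Y}) (i : I) : A != set0 ->
  exists y, forall x, (x \in A) && [forall z in A, u i z <= u i x] = (x == y).
Proof.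
case/set0Pn=> y0 y0A; exists [arg max_(y > y0 in A) u i y].
case: arg_maxnP => // y yA ymax x; apply/andP/eqP => [[xA /forall_inP xmax]|->].
  by apply: (u_inj (i := i)); apply/eqP; rewrite eqn_leq [_ <= _]ymax ?xmax.
by split=> //; apply/forall_inP => z zA; exact: ymax.
Qed.

(** A dominant door lies in two rooms, one from each of two disjoint candidate sets; nonemptiness
    excludes boundary doors, where a set may be empty. Other doors lie in no room. *)
Lemma door_even (S : {set Y}) : S != set0 -> #|S|.+1 = #|I| ->
  (forall j, above S j != set0) ->
  ~~ odd #|[set y | (y \notin S) && dominant (y |: S)]|.
Proof.
move=> S0 cardS ne.
have [domS|domS] := boolP (dominant S); last first.
  rewrite (_ : [set y | _] = set0) ?cards0 //; apply/setP => y; rewrite !inE.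
  apply/negP => /andP[_ h]; move/negP: domS; apply.
  by apply: dominantS h; apply: subsetUr.
have [j [k [dis roomE]]] := door_rooms S0 domS cardS.
have [yj hj] := card_argmax j (ne j).
have [yk hk] := card_argmax k (ne k).
have yjj : yj \in above S j by have := hj yj; rewrite eqxx => /andP[].
have ykk : yk \in above S k by have := hk yk; rewrite eqxx => /andP[].
rewrite (_ : [set y | _] = [set yj; yk]).
  rewrite cards2 (_ : yj != yk) //; apply: contraTneq yjj => ->.
  by rewrite (disjointFl dis).
apply/setP => y; rewrite inE roomE in_set2 -hj -hk.
apply/exists_inP/orP => [[i]|[h|h]].
- by rewrite in_set2 => /orP[]/eqP-> ?; [left|right].
- by exists j; rewrite // set21.
- by exists k; rewrite // set22.
Qed.

(* Passing from pairs (door, added point) to pairs (room, removed point). *)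
Lemma door_room_count (Q : pred {set Y}) :
  \sum_(S | Q S) #|[set y | (y \notin S) && dominant (y |: S)]| =
  \sum_(R | dominant R) #|[set y in R | Q (R :\ y)]|.
Proof.
under eq_bigr do rewrite -sum1_card.
under [RHS]eq_bigr do rewrite -sum1_card.
rewrite (exchange_big_dep xpredT) //= [RHS](exchange_big_dep xpredT) //=.
apply: eq_bigr => y _.
rewrite (reindex_onto (fun R => R :\ y) (fun S => y |: S)) /=; last first.
  by move=> S /andP[_]; rewrite inE => /andP[yS _]; rewrite setU1K.
apply: eq_bigl => R; rewrite !inE eqxx /=.
have [yR|yR] := boolP (y \in R); first by rewrite setD1K // eqxx !andbT andbC.
rewrite !andbF; apply/negP => /andP[_ /eqP e].
by move: yR; rewrite -e !inE eqxx.
Qed.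

(** If some removal leaves all colours but [i0], then [R] itself lacks [i0] and exactly two of its
    points share a colour; these two are the removable points. *)
Lemma room_even (c : Y -> I) (i0 : I) (R : {set Y}) : #|R| = #|I| ->
  c @: R != setT -> ~~ odd #|[set y in R | c @: (R :\ y) == [set~ i0]]|.
Proof.
move=> cardR nfull; set A := [set y in R | _].
have [->|/set0Pn[y yA]] := eqVneq A set0; first by rewrite cards0.
have := yA; rewrite inE => /andP[yR /eqP cy].
have injA a : a \in A -> {in R :\ a &, injective c}.
  rewrite inE => /andP[aR /eqP ca]; apply/imset_injP.
  by rewrite ca cardsC1 -cardR (cardsD1 a R) aR.
have cRE : c @: R = c y |: [set~ i0] by rewrite -cy -imsetU1 setD1K.
have cyi0 : c y != i0.
  by apply: contraNneq nfull => e; rewrite cRE e setUCr.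
have : c y \in c @: (R :\ y) by rewrite cy !inE.
case/imsetP => y' /setD1P[y'y y'R] cyy'.
have yy' : y != y' by rewrite eq_sym.
rewrite (_ : A = [set y; y']) ?cards2 ?yy' //.
apply/setP => x; rewrite !inE.
apply/andP/orP => [[xR cx]|[/eqP->|/eqP->]]; last 2 first.
- by rewrite yR cy.
- split=> //; rewrite -cy; apply/eqP/setP => i.
  apply/imsetP/imsetP => -[a]; rewrite !inE => /andP[aa aR ->].
    have [->|ay] := eqVneq a y; first by exists y'; rewrite ?inE ?y'y.
    by exists a; rewrite ?inE ?ay.
  have [->|ay] := eqVneq a y'; first by exists y; rewrite ?inE ?yy'.
  by exists a; rewrite ?inE ?ay.
have [->|xy] := eqVneq x y; first by left.
right; apply/negPn/negP => xy'.
have xA : x \in A by rewrite inE xR.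
have := injA x xA y y'; rewrite !inE yR y'R !(eq_sym _ x) xy xy' cyy'.
by move=> /(_ isT isT erefl)/eqP; rewrite (negbTE yy').
Qed.

End DominantSets.

(** * Slack elements, the parity count and Scarf's lemma *)

Section Scarf.
Variables (I X : finType) (u : I -> X -> nat) (c : X -> I) (x0 : X) (i0 : I).
Hypothesis u_inj : forall i, injective (u i).

(* The slack element [inr i] is the worst one for [i] and beats every proper
   element for the other indices, and it has colour [i]. *)
Definition slack_rank (i : I) (y : X + I) : nat :=
  match y with
  | inl x => (u i x).+1
  | inr j =>
      if j == i then 0 else ((\max_k \max_x u k x).+2 + enum_rank j)%N
  end.

Definition slack_color (y : X + I) : I :=
  match y with inl x => c x | inr i => i end.

Lemma slack_rank_lt (i j : I) (x : X) :
  j != i -> slack_rank i (inl x) < slack_rank i (inr j).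
Proof.
move=> ji /=; rewrite (negbTE ji); apply: leq_trans (leq_addr _ _); rewrite !ltnS.
by apply: leq_trans (leq_bigmax i); apply: leq_bigmax.
Qed.

Lemma slack_rank_inj (i : I) : injective (slack_rank i).
Proof.
move=> [x|j] [x'|j'].
- by move=> [/u_inj->].
- have [->//|j'i e] := eqVneq j' i; first by rewrite /= eqxx.
  by have := slack_rank_lt x j'i; rewrite e ltnn.
- have [->//|ji e] := eqVneq j i; first by rewrite /= eqxx.
  by have := slack_rank_lt x' ji; rewrite e ltnn.
- rewrite /=; case: eqVneq => [->|_]; case: eqVneq => [->|_] //.
  by move/addnI/ord_inj/enum_rank_inj ->.
Qed.

Let S0 : {set X + I} := inr @: [set~ i0].

(** The boundary door [S0] lies in a single room: only the proper point best for [i0] completes it,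
    because the set of all slacks is beaten by any proper point. *)
Lemma slack_door_odd :
  odd #|[set y | (y \notin S0) && dominant slack_rank (y |: S0)]|.
Proof.
pose xm := [arg max_(x > x0) u i0 x].
have hxm x : u i0 x <= u i0 xm by rewrite /xm; case: arg_maxnP => // y _; apply.
have inS0 j : (inr j \in S0) = (j != i0).
  apply/imsetP/idP => [[k hk [->]]|ji]; first by rewrite !inE in hk.
  by exists j; rewrite ?inE.
have inlS0 x : inl x \notin S0 by apply/imsetP => -[].
rewrite (_ : [set y | _] = [set inl xm]) ?cards1 //.
apply/setP => y; rewrite !inE; apply/andP/eqP => [[yS /dominantP dom]|->].
  case: y yS dom => [x _|j] dom; last first.
    rewrite inS0 negbK in dom; rewrite (eqP dom) => {j dom} dom.
    have [i /(_ (inr i))] := dom (inl x0).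
    rewrite in_setU1 inS0 /= eqxx ltn0.
    by have [->|_] := eqVneq i i0; rewrite ?eqxx ?orbT => /(_ isT).
  have [i hi] := dom (inl xm).
  have ii0 : i = i0.
    apply/eqP/negPn/negP => ii0; have := hi (inr i).
    by rewrite !inE inS0 ii0 /= eqxx ltn0 => /(_ isT).
  have := hi (inl x); rewrite !inE eqxx ii0 => /(_ isT) /= h.
  by congr inl; apply: (u_inj (i := i0)); apply/eqP; rewrite eqn_leq hxm -ltnS.
split=> //; apply/dominantP => -[x|j]; last by exists j => s _; rewrite /= eqxx.
exists i0 => -[x'|j]; rewrite !inE.
  by case/orP => [/eqP[->]|]; [exact: hxm|rewrite (negbTE (inlS0 _))].
by rewrite inS0 => ji; apply/ltnW/slack_rank_lt.
Qed.

(** Count modulo 2 the pairs of a door coloured by [[set~ i0]] and a room containing it. By doors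
    the count is odd, as only [S0] lies in an odd number of rooms; by rooms, each one lacking a
    colour contributes an even number. *)
Lemma full_room : exists2 R : {set X + I}, dominant slack_rank R &
  #|R| = #|I| /\ slack_color @: R = setT.
Proof.
pose Q (S : {set X + I}) :=
  (slack_color @: S == [set~ i0]) && (#|S|.+1 == #|I|).
have [/exists_inP[R dR /andP[/eqP cR /eqP fR]]|/exists_inPn nofull] :=
  boolP [exists R in dominant slack_rank,
           (#|R| == #|I|) && (slack_color @: R == setT)].
  by exists R.
have := door_room_count slack_rank Q.
move/(congr1 odd).
have QS0 : Q S0.
  rewrite /Q -imset_comp (eq_imset (g := id)) // imset_id eqxx /=.
  rewrite card_imset; last by move=> ? ? [].
  by rewrite cardsC1 prednK //; apply/card_gt0P; exists i0.
rewrite (bigD1 S0) //= oddD slack_door_odd.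
have odd_sum (P : pred {set X + I}) F : (forall S, P S -> ~~ odd (F S)) ->
    odd (\sum_(S | P S) F S) = false.
  move=> h; apply/negbTE; elim/big_ind: _ => // a b; rewrite oddD.
  by move=> /negbTE-> /negbTE->.
rewrite !odd_sum // => R.
  move=> dR; have [->|/set0Pn[y]] := eqVneq [set y in R | Q (R :\ y)] set0.
    by rewrite cards0.
  rewrite inE => /andP[yR /andP[_ /eqP cR]].
  have {}cR : #|R| = #|I| by rewrite -cR (cardsD1 y R) yR.
  rewrite (_ : [set y in R | _] =
               [set y in R | slack_color @: (R :\ y) == [set~ i0]]).
    apply: room_even => //; apply: contraNneq (nofull R dR) => ->.
    by rewrite cR !eqxx.
  apply/setP => z; rewrite !inE /Q; have [zR|//] := boolP (z \in R).
  by rewrite -cR (cardsD1 z R) zR eqxx andbT.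
case/andP=> /andP[/eqP cR /eqP nR] RS0.
have inrR j : inr j \in R -> j != i0.
  move=> jR; have : slack_color (inr j) \in slack_color @: R by apply: imset_f.
  by rewrite cR !inE.
(* Without a proper point, this door would consist of slacks other than that of [i0] and, by its
   size, equal [S0]. A proper point puts the slack of each [j] in [above R j]. *)
have [x xR] : exists x, inl x \in R.
  apply/existsP; rewrite -(negbK [exists x, _]) negb_exists.
  apply: contraNN RS0 => /forallP noinl; rewrite eqEcard; apply/andP; split.
    apply/subsetP => -[x|j] h; first by have := noinl x; rewrite h.
    by apply: imset_f; rewrite !inE inrR.
  by move/andP: QS0 => [_ /eqP]; rewrite -nR => -[->].
apply: door_even => //; [exact: slack_rank_inj|by apply/set0Pn; exists (inl x)|].
move=> j; apply/set0Pn; exists (inr j); apply/aboveP => i ij.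
by exists (inl x) => //; apply: slack_rank_lt; rewrite eq_sym.
Qed.

(** Discard the slacks of a fully coloured room. Where the slack of [i] is present, the minimum for
    [i] is 0 and every proper point beats it, so dominance is witnessed in [C]. *)
Theorem scarf : exists (T : {set X}) (C : {set I}),
  (forall i, i \in C -> exists2 t, t \in T & c t = i) /\
  (forall x, exists2 i, i \in C & forall t, t \in T -> u i x <= u i t).
Proof.
have [R /dominantP dR [_ cR]] := full_room.
exists [set x | inl x \in R], [set i | inr i \notin R]; split=> [i|x].
  rewrite inE => iR; have : i \in slack_color @: R by rewrite cR.
  case/imsetP => -[x|j] hR /= e; first by exists x; rewrite ?inE.
  by move: iR; rewrite e hR.
have [i hi] := dR (inl x); exists i => [|t]; rewrite inE.
  by apply/negP => /hi; rewrite /= eqxx ltn0.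
by move/hi.
Qed.

End Scarf.

(* [t] ranges over the cell of a dominant pair [(T, C)] of grid points: the
   minima [m i] over [T] for [i] in [C] satisfy [K < \sum_(i in C) (m i).+1], so
   all points of [T] are close and nearly vanish off [C]. *)
Lemma grid_scarf (I : finType) (K : nat) (i0 : I) (c : (I -> nat) -> I) :
  exists x : I -> nat, \sum_i x i = K /\
    forall i, x i <= #|I| \/
      exists t : I -> nat, [/\ \sum_j t j = K, c t = i &
        forall j, x j <= t j + #|I| /\ t j <= x j + #|I|].
Proof.
pose X : finType := {x : {ffun I -> 'I_K.+1} | \sum_i (x i : nat) == K}.
pose coord (x : X) (i : I) : nat := val x i.
have coord_sum x : \sum_i coord x i = K by apply/eqP/(valP x).
have gridI (f : I -> nat) : \sum_i f i = K -> exists x, coord x =1 f.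
  move=> fK.
  have fle i : f i <= K by rewrite -fK (bigD1 i) //= leq_addr.
  have hx : \sum_i ([ffun i => inord (f i) : 'I_K.+1] i : nat) == K.
    by apply/eqP; rewrite -[RHS]fK; apply: eq_bigr => i _; rewrite ffunE inordK ?ltnS.
  exists (Sub [ffun i => inord (f i)] hx : X) => i; by rewrite /coord /= ffunE inordK ?ltnS.
have [x0 _] : exists x, coord x =1 (fun i => if i == i0 then K else 0).
  by apply: gridI; rewrite -big_mkcond big_pred1_eq.
(* Ties between equal coordinates are broken by [enum_rank], which stays below the factor [#|X|]. *)
pose u (i : I) (x : X) := coord x i * #|X| + enum_rank x.
have u_inj i : injective (u i).
  move=> x y /(congr1 (fun k => k %% #|X|)); rewrite /u !modnMDl !modn_small //.
  by move=> /ord_inj/enum_rank_inj.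
have u_mono i x y : u i x <= u i y -> coord x i <= coord y i.
  apply: contraTT; rewrite -!ltnNge => lt_yx.
  apply: leq_trans (leq_addr _ _).
  apply: (@leq_trans ((coord y i).+1 * #|X|)); last by rewrite leq_mul2r lt_yx orbT.
  by rewrite mulSnr -addnS leq_add2l ltn_ord.
have [T [C [colT domT]]] := scarf (fun x => c (coord x)) x0 i0 u_inj.
have [i1 i1C _] := domT x0; have [t0 t0T _] := colT i1 i1C.
pose m i := coord [arg min_(t < t0 in T) coord t i] i.
have mP i : (exists2 t, t \in T & m i = coord t i) /\
    forall t, t \in T -> m i <= coord t i.
  rewrite /m; case: arg_minnP => // t tT tmin; split=> //; by exists t.
have sum_m : K < \sum_(i in C) (m i).+1.
  rewrite ltnNge; apply/negP => le_mK.
  (* This grid point exceeds [m i] for every [i] in [C], with the leftover mass at [i1]; the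
     domination by [T] and [C] forbids it. *)
  pose f i := if i \in C then
    (m i).+1 + (if i == i1 then K - \sum_(i in C) (m i).+1 else 0) else 0.
  have [g gE] : exists g, coord g =1 f.
    apply: gridI; rewrite -big_mkcond big_split /= -big_mkcondr /=.
    rewrite [X in _ + X](eq_bigl (pred1 i1)) ?big_pred1_eq ?subnKC // => i /=.
    by case: eqVneq => [->|_]; rewrite ?i1C ?andbF.
  have [i iC hi] := domT g; have [t tT mt] := (mP i).1.
  have := u_mono _ _ _ (hi t tT); rewrite gE /f iC -mt.
  by apply/negP; rewrite -ltnNge ltn_addr.
have sum_mE : \sum_(i in C) (m i).+1 = \sum_(i in C) m i + #|C|.
  rewrite -sum1_card -big_split; apply: eq_bigr => i _ /=; by rewrite addn1.
have CI : #|C| <= #|I| by apply: max_card.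
have sumC t : \sum_(i in C) coord t i + \sum_(i | i \notin C) coord t i = K.
  by rewrite -(coord_sum t) [RHS](bigID (mem C)).
(* The coordinates of [t] in [C] already sum to more than [K - #|C|], so fewer than [#|C|] units
   remain. *)
have offC t i : t \in T -> i \notin C -> coord t i <= #|I|.
  move=> tT iC.
  have h1 : \sum_(i in C) m i <= \sum_(i in C) coord t i.
    by apply: leq_sum => j jC; apply: (mP j).2.
  have h2 : coord t i <= \sum_(i | i \notin C) coord t i.
    by rewrite (bigD1 i) //= leq_addr.
  have h3 := sumC t; move: sum_m CI h1 h2 h3; rewrite sum_mE; lia.
have onC t i : t \in T -> i \in C -> coord t i <= m i + #|I|.
  move=> tT iC.
  have h1 : \sum_(j in C | j != i) m j <= \sum_(j in C | j != i) coord t j.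
    by apply: leq_sum => j /andP[jC _]; apply: (mP j).2.
  have h2 F : \sum_(j in C) F j = F i + \sum_(j in C | j != i) F j.
    exact: bigD1.
  have h3 := sumC t; move: sum_m CI h1 h3; rewrite sum_mE !h2; lia.
have cell t t' j : t \in T -> t' \in T -> coord t j <= coord t' j + #|I|.
  move=> tT t'T; have [jC|jC] := boolP (j \in C); last first.
    exact: leq_trans (offC t j tT jC) (leq_addl _ _).
  by rewrite (leq_trans (onC t j tT jC)) // leq_add2r (mP j).2.
exists (coord t0); split=> // i; have [iC|iC] := boolP (i \in C); last first.
  by left; apply: offC.
right; have [t tT ct] := colT i iC; exists (coord t); split=> // j.
by split; apply: cell.
Qed.

Require Import Defs.
From HB Require Import structures.
From mathcomp Require Import all_boot all_order all_algebra.
From mathcomp Require Import all_classical all_reals all_analysis.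
From mathcomp Require Import lra.

Import Order.TTheory GRing.Theory Num.Theory.
Import numFieldNormedType.Exports.

Local Open Scope classical_set_scope.
Local Open Scope ring_scope.

(** * Brouwer's theorem on the simplex *)

Section Convergence.
Context {R : realType} {S : Type} {F : set_system S} {FF : Filter F}.

Lemma cvg_mx m n (f : S -> 'M[R]_(m, n)) (A : 'M[R]_(m, n)) :
  (forall i j, f s i j @[s --> F] --> A i j) -> f @ F --> A.
Proof.
move=> h B [P PA PB].
have : \forall s \near F, forall i j, P i j (f s i j).
  by apply: filter_forall => i; apply: filter_forall => j; apply: h.
by apply: filterS => s hs; apply: PB.
Qed.

Lemma cvg_coord m n (f : S -> 'M[R]_(m, n)) (A : 'M[R]_(m, n)) i j :
  f @ F --> A -> f s i j @[s --> F] --> A i j.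
Proof.
move=> h.
exact: (@cvg_comp _ _ _ f (fun M : 'M[R]_(m, n) => M i j) F (nbhs A) _ h
  (@coord_continuous R m n i j A)).
Qed.

Lemma cvg_sum (I : Type) (r : seq I) (f : I -> S -> R) (a : I -> R) :
  (forall i, f i s @[s --> F] --> a i) ->
  \sum_(i <- r) f i s @[s --> F] --> \sum_(i <- r) a i.
Proof.
move=> h; elim: r => [|i r IH].
  by rewrite big_nil; under eq_fun do rewrite big_nil; exact: cvg_cst.
by rewrite big_cons; under eq_fun do rewrite big_cons; apply: cvgD.
Qed.

End Convergence.

Lemma mx_compact (R : realType) m n (A : set R) : compact A ->
  compact [set M : 'M[R]_(m, n) | forall i j, A (M i j)].
Proof.
move=> cA.
have -> : [set M : 'M[R]_(m, n) | forall i j, A (M i j)] =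
    vec_mx @` [set v : 'rV[R]_(m * n) | forall k, A (v 0 k)].
  apply/seteqP; split => [M hM|_ [v hv <-] i j]; last by rewrite mxE.
  exists (mxvec M); last exact: mxvecK.
  by move=> k /=; case/mxvec_indexP: k => i j; rewrite mxvecE.
apply: continuous_compact; last exact: (rV_compact (A := fun=> A)).
apply: continuous_subspaceT => v; apply: (cvg_mx (F := nbhs v)) => i j.
under eq_fun do rewrite mxE; rewrite mxE; exact: coord_continuous.
Qed.

Section Simplex.
Variable R : realType.

Lemma simplex_le1 d (q : 'rV[R]_d) j : simplex q -> q 0 j <= 1.
Proof. by case=> q0 <-; rewrite (bigD1 j) //= lerDl sumr_ge0. Qed.

Lemma closed_simplex d : closed (@simplex R d).
Proof.
have -> : @simplex R d = \bigcap_j [set q : 'rV[R]_d | 0 <= q 0 j] `&`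
    [set q : 'rV[R]_d | \sum_j q 0 j = 1].
  apply/seteqP; split=> q [h1 h2]; split=> // j; first by move=> _; apply: h1.
  exact: h1.
apply: closedI.
  apply: closed_bigI => j _.
  apply: (closed_comp (f := fun q : 'rV[R]_d => q 0 j) (D := [set a | 0 <= a]));
    last exact: closed_ge.
  by move=> q _; apply: coord_continuous.
apply: (closed_comp (f := fun q : 'rV[R]_d => \sum_j q 0 j)
  (D := [set a | a = 1])); last exact: closed_eq.
by move=> q _; apply: (cvg_sum (F := nbhs q)) => j; apply: coord_continuous.
Qed.

Lemma compact_simplex d : compact (@simplex R d).
Proof.
have h := @mx_compact R 1 d _ (@segment_compact R 0 1).
refine (subclosed_compact (@closed_simplex d) h _).
move=> q hq i j /=; rewrite ord1 in_itv /= simplex_le1 // andbT; exact: hq.1.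
Qed.

Lemma closed_stochastic d : closed (@stochastic R d).
Proof.
have -> : @stochastic R d = \bigcap_i [set P | simplex (row i P)].
  by apply/seteqP; split=> P h i; [move=> _; exact: h|exact: (h i)].
apply: closed_bigI => i _.
apply: (closed_comp (f := row i) (D := @simplex R d)); last exact: closed_simplex.
move=> P _; apply: (cvg_mx (F := nbhs P)) => i' j.
by under eq_fun do rewrite mxE; rewrite mxE; apply: coord_continuous.
Qed.

Lemma compact_stochastic d : compact (@stochastic R d).
Proof.
have h := @mx_compact R d d _ (@segment_compact R 0 1).
refine (subclosed_compact (@closed_stochastic d) h _).
move=> P hP i j /=; have := simplex_le1 j (hP i); have := (hP i).1 j.
by rewrite !mxE in_itv /= => -> ->.
Qed.

Lemma approx_fixpoint n (f : 'rV[R]_n.+1 -> 'rV[R]_n.+1) (K : nat) :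
  (forall x, simplex x -> simplex (f x)) ->
  exists2 x, simplex x & forall i, x 0 i <= n.+1%:R / K.+1%:R \/
    exists t, [/\ simplex t, t 0 i <= f t 0 i &
      forall j, `|x 0 j - t 0 j| <= n.+1%:R / K.+1%:R].
Proof.
move=> fS.
pose pt (x : 'I_n.+1 -> nat) : 'rV[R]_n.+1 := \row_i ((x i)%:R / K.+1%:R).
(* The default only concerns tuples off the grid: on it, [pt x] and its image both have coordinate
   sum 1, so a suitable index exists. *)
pose c x := odflt ord0 [pick i | pt x 0 i <= f (pt x) 0 i].
have ptS x : (\sum_i x i = K.+1)%N -> simplex (pt x).
  move=> xK; split=> [j|]; first by rewrite mxE divr_ge0.
  under eq_bigr do rewrite mxE.
  by rewrite -mulr_suml -natr_sum xK divff // pnatr_eq0.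
have cP x : (\sum_i x i = K.+1)%N -> pt x 0 (c x) <= f (pt x) 0 (c x).
  move=> xK; rewrite /c; case: pickP => //= none.
  have : \sum_j f (pt x) 0 j < \sum_j pt x 0 j.
    apply: ltr_sum => [|i _]; first by apply/hasP; exists ord0; rewrite ?mem_index_enum.
    by rewrite ltNge none.
  by rewrite (fS _ (ptS x xK)).2 (ptS x xK).2 ltxx.
have [x [xK hx]] := grid_scarf K.+1 ord0 c.
exists (pt x); first exact: ptS.
move=> i; rewrite card_ord in hx.
have K0 : 0 <= K.+1%:R^-1 :> R by rewrite invr_ge0.
case: (hx i) => [xi|[t [tK ct h]]]; [left|right].
  by rewrite mxE ler_wpM2r // ler_nat.
exists (pt t); split=> [||j]; [exact: ptS|by rewrite -ct; exact: cP|].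
rewrite !mxE -mulrBl normrM (ger0_norm K0) ler_wpM2r //.
by have [h1 h2] := h j; rewrite ler_norml -(ler_nat R) in h1 h2 *;
  move: h1 h2; rewrite -!(ler_nat R) !natrD => h1 h2; apply/andP; split; lra.
Qed.

(** A cluster point [y] of approximate fixed points satisfies [y 0 i <= f y 0 i] for all [i]; both
    sides sum to 1, so equality holds. *)
Theorem brouwer_simplex n (f : 'rV[R]_n -> 'rV[R]_n) : (0 < n)%N ->
  {within @simplex R n, continuous f} ->
  (forall x, simplex x -> simplex (f x)) -> exists2 x, simplex x & f x = x.
Proof.
case: n f => // n f _ /subspace_continuousP fc fS.
have /choice[x xP] K : exists x, simplex x /\ forall i,
    x 0 i <= n.+1%:R / K.+1%:R \/
    exists t, [/\ simplex t, t 0 i <= f t 0 i &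
      forall j, `|x 0 j - t 0 j| <= n.+1%:R / K.+1%:R].
  by have [y] := approx_fixpoint K fS; exists y.
have [|y [yS ycl]] := @compact_simplex n.+1 (x @ \oo).
  by exists 0%N => // K _; apply: (xP K).1.
exists y => //.
have le_f i : y 0 i <= f y 0 i.
  rewrite leNgt; apply/negP => lti.
  have y0 : 0 < y 0 i by apply: le_lt_trans lti; exact: (fS _ yS).1.
  have : \forall t \near within (@simplex R n.+1) (nbhs y), f t 0 i < t 0 i.
    have h1 : (fun t : 'rV[R]_n.+1 => t 0 i - f t 0 i) @
          within (@simplex R n.+1) (nbhs y) -->
        y 0 i - f y 0 i.
      apply: cvgB; first by apply: cvg_coord; exact: cvg_within.
      by apply: cvg_coord; exact: fc.
    have := cvgr_gt _ h1 0; rewrite subr_gt0 => /(_ _ lti).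
    by apply: filterS => t; rewrite subr_gt0.
  rewrite near_withinE => /nbhs_ballP[e /= e0 he].
  (* With the mesh and the distance to [y] below [r], the bound by [y 0 i] rules out a small
     coordinate, and the bound by [e] puts [t] in the ball where [f] lowers it. *)
  have [r [r0 re ry]] : exists r : R, [/\ 0 < r, r + r <= e & r + r <= y 0 i].
    exists (Num.min e (y 0 i) / 2).
    by rewrite -splitr !ge_min !lexx orbT divr_gt0 // lt_min e0.
  have [K0 _ hK0] : \forall K \near \oo, n.+1%:R / K.+1%:R < r.
    have h : (fun K => n.+1%:R * K.+1%:R^-1 : R) @ \oo --> (n.+1%:R * 0 : R).
      by apply: cvgM; [exact: cvg_cst|exact: cvg_harmonic].
    by rewrite mulr0 in h; apply: (cvgr_lt _ h).
  have [] := ycl (x @` [set K | (K0 <= K)%N]) (ball y r).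
  - by exists K0 => // K hK; exists K.
  - exact: nbhsx_ballx.
  move=> _ [[K /= hK <-] [_ xy]].
  have {}xy j := xy 0 j.
  have := (xP K).2 i; have := hK0 K hK; rewrite /=.
  move: (n.+1%:R / K.+1%:R) => q qr.
  rewrite /ball /= in xy.
  case=> [h3|[t [tS tf tx]]].
    by have := xy i; rewrite ltr_norml => /andP[h1 h2]; lra.
  suff /he/(_ tS) : ball y e t by rewrite ltNge tf.
  split=> // i' j; rewrite (ord1 i') /ball /=.
  have := ler_distD (x K 0 j) (y 0 j) (t 0 j).
  by have h1 := xy j; have h2 := tx j; move=> h3; lra.
apply/rowP => i; apply/esym/eqP; move: i.
have h := (fS y yS).2; rewrite -yS.2 in h.
have : \sum_i (f y 0 i - y 0 i) = 0 by rewrite sumrB h subrr.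
move/eqP; rewrite psumr_eq0 => [|i _]; last by rewrite subr_ge0.
by move=> /allP h0 i; have := h0 i (mem_index_enum i); rewrite subr_eq0 eq_sym.
Qed.

End Simplex.

(** * Continuity of the Nash minimizer *)

Lemma cvg_to_within (S : Type) (T : topologicalType) (F : set_system S)
    {FF : Filter F} (A : set T) (f : S -> T) (x : T) :
  f @ F --> x -> (\forall s \near F, A (f s)) -> f @ F --> within A (nbhs x).
Proof.
by move=> fx fA B hB; apply: filterS2 fA (fx _ hB) => s As; apply.
Qed.

(** Each [z] other than [y] is locally avoided by [f]; compactness of [K] minus an open
    neighbourhood of [y] makes the avoidance uniform. *)
Lemma closed_graph_cvg (S : Type) (T : topologicalType) (F : set_system S)
    {FF : Filter F} (K : set T) (f : S -> T) (y : T) :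
  compact K -> (\forall s \near F, K (f s)) ->
  (forall z, K z -> z <> y ->
     \forall z' \near z & s \near F, K z' -> f s <> z') ->
  f @ F --> y.
Proof.
move=> cK fK h U hU.
have cKU : compact (K `&` ~` U°).
  apply: compact_closedI => //; apply: open_closedC; exact: open_interior.
have /compact_near_coveringP/near_covering_withinP cov := cKU.
have hF : \forall s \near F, K `&` ~` U° `<=` (fun z => f s <> z).
  apply: cov => z [Kz Uz].
  have zy : z <> y.
    by move=> zy; apply: Uz; rewrite zy; exact: nbhs_singleton (nbhs_interior hU).
  by apply: filterS (h z Kz zy) => -[z' s] /= h' [Kz' _]; exact: h'.
apply: filterS2 fK hF => s Ks hs.
by apply: contrapT => nU; apply: (hs (f s)) => //; split=> // /interior_subset.
Qed.

Section NashMinimizer.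
Variables (R : realType) (d : nat) (c : transition_costs R d).
Hypothesis uniq_nash : forall (p : 'rV[R]_d) (V : 'cV[R]_d), simplex p ->
  exists! P : 'M[R]_d, nash_minimizer c p V P.
Hypothesis cost_continuous : forall i : 'I_d,
  {within @simplex R d `*` @stochastic R d `*` [set: 'cV[R]_d],
   continuous (fun x : 'rV[R]_d * 'M[R]_d * 'cV[R]_d =>
     expected_cost c i x.1.1 x.1.2 x.2)}.

Lemma the_nash_minimizerP p V :
  simplex p -> nash_minimizer c p V (the_nash_minimizer c p V).
Proof.
by move=> hp; have [P [hP _]] := uniq_nash V hp; apply: xgetPex; exists P.
Qed.

Lemma nash_minimizer_unique p V P :
  simplex p -> nash_minimizer c p V P -> P = the_nash_minimizer c p V.
Proof.
move=> hp hP; have [Q [_ Qu]] := uniq_nash V hp.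
by rewrite -(Qu _ hP) -(Qu _ (the_nash_minimizerP V hp)).
Qed.

Lemma stochastic_replace_row (P : 'M[R]_d) q i :
  stochastic P -> simplex q -> stochastic (replace_row P q i).
Proof.
move=> hP hq k; have [ki|ki] := eqVneq k i.
  suff -> : row k (replace_row P q i) = q by [].
  by apply/rowP => j; rewrite !mxE ki eqxx.
suff -> : row k (replace_row P q i) = row k P by exact: hP.
by apply/rowP => j; rewrite !mxE (negbTE ki).
Qed.

Section Limits.
Context {S : Type} {F : set_system S} {FF : Filter F}.
Variables (p : S -> 'rV[R]_d) (V : S -> 'cV[R]_d).
Variables (p0 : 'rV[R]_d) (V0 : 'cV[R]_d).
Hypothesis simplex_p0 : simplex p0.
Hypothesis simplex_p : \forall s \near F, simplex (p s).
Hypothesis cvg_p : p @ F --> p0.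
Hypothesis cvg_V : V @ F --> V0.

(** The filter is arbitrary because the next limits are also taken along pairs of a varying matrix
    and a parameter. *)
Lemma cvg_expected_cost (P : S -> 'M[R]_d) (P0 : 'M[R]_d) i :
  stochastic P0 -> (\forall s \near F, stochastic (P s)) -> P @ F --> P0 ->
  expected_cost c i (p s) (P s) (V s) @[s --> F] -->
    expected_cost c i p0 P0 V0.
Proof.
move=> hP0 hP cP.
have /subspace_continuousP h := @cost_continuous i.
have {}h := h (p0, P0, V0) (conj (conj simplex_p0 hP0) I).
refine (@cvg_comp _ _ _ (fun s => (p s, P s, V s)) _ _ _ _ _ h).
apply: cvg_to_within.
  exact: (cvg_pair (cvg_pair cvg_p cP) cvg_V).
by apply: filterS2 simplex_p hP.
Qed.

Lemma cvg_replace_row (P : S -> 'M[R]_d) (P0 : 'M[R]_d) q i :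
  P @ F --> P0 -> replace_row (P s) q i @[s --> F] --> replace_row P0 q i.
Proof.
move=> cP; apply: cvg_mx => k j; rewrite mxE; under eq_fun do rewrite mxE.
by case: ifP => _; [exact: cvg_cst|exact: cvg_coord].
Qed.

End Limits.

Section MinimizerLimits.
Context {S : Type} {F : set_system S} {FF : Filter F}.
Variables (p : S -> 'rV[R]_d) (V : S -> 'cV[R]_d).
Variables (p0 : 'rV[R]_d) (V0 : 'cV[R]_d).
Hypothesis simplex_p0 : simplex p0.
Hypothesis simplex_p : \forall s \near F, simplex (p s).
Hypothesis cvg_p : p @ F --> p0.
Hypothesis cvg_V : V @ F --> V0.

Lemma near_nash_stochastic :
  \forall s \near F, stochastic (the_nash_minimizer c (p s) (V s)).
Proof.
by apply: filterS simplex_p => s hs; case: (the_nash_minimizerP (V s) hs).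
Qed.

(** If [P] is not the minimizer at the limit, some row deviation [q] strictly lowers a cost. By
    continuity this persists for stochastic matrices near [P] and parameters far along [F], so none
    of these matrices is a minimizer there. *)
Lemma cvg_the_nash_minimizer :
  the_nash_minimizer c (p s) (V s) @[s --> F] --> the_nash_minimizer c p0 V0.
Proof.
apply: (closed_graph_cvg (@compact_stochastic R d)) => [|P hP Pneq].
  exact: near_nash_stochastic.
have [i [q [hq lt_q]]] : exists i q, simplex q /\
    expected_cost c i p0 (replace_row P q i) V0 < expected_cost c i p0 P V0.
  apply: contrapT => none; apply: Pneq.
  apply: nash_minimizer_unique => //; split=> // i q hq.
  by rewrite leNgt; apply/negP => h; apply: none; exists i, q.
pose G := filter_prod (within (@stochastic R d) (nbhs P)) F.
have FG : Filter G by apply: filter_prod_filter.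
have cfst : fst @ G --> P by apply: cvg_trans cvg_fst _; exact: cvg_within.
have csnd : snd @ G --> F by exact: cvg_snd.
have stG : \forall t \near G, stochastic t.1.
  by apply: (cvg_fst (F := within (@stochastic R d) (nbhs P))); exact: withinT.
have spG : \forall t \near G, simplex (p t.2) by exact: csnd simplex_p.
have cpG : (fun t => p t.2) @ G --> p0 by exact: cvg_comp csnd cvg_p.
have cVG : (fun t => V t.2) @ G --> V0 by exact: cvg_comp csnd cvg_V.
have c1 := cvg_expected_cost (FF := FG) (i := i) simplex_p0 spG cpG cVG hP stG cfst.
have c2 : (fun t => expected_cost c i (p t.2) (replace_row t.1 q i) (V t.2)) @ G
    --> expected_cost c i p0 (replace_row P q i) V0.
  apply: cvg_expected_cost => //; first exact: stochastic_replace_row.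
    by apply: filterS stG => t ht; exact: stochastic_replace_row.
  exact: cvg_replace_row.
have : \forall t \near G, t.1 <> the_nash_minimizer c (p t.2) (V t.2).
  have := cvgr_gt _ (cvgB c1 c2) 0; rewrite subr_gt0 => /(_ FG FG lt_q).
  apply: filterS2 spG => t ht; rewrite /= subr_gt0 ltNge => /negP h e.
  by apply: h; rewrite e; exact: (the_nash_minimizerP (V t.2) ht).2.
case=> -[A B] /= [hA hB] AB; exists (fun z => stochastic z -> A z, B) => //=.
by move=> [z s] /= [Az Bs] zst /esym; exact: (AB (z, s) (conj (Az zst) Bs)).
Qed.

Lemma cvg_value_step :
  value_step c (p s) (V s) @[s --> F] --> value_step c p0 V0.
Proof.
apply: cvg_mx => i j; rewrite mxE; under eq_fun do rewrite mxE.
apply: cvg_expected_cost => //; last exact: cvg_the_nash_minimizer.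
  by case: (the_nash_minimizerP V0 simplex_p0).
exact: near_nash_stochastic.
Qed.

Lemma cvg_distribution_step :
  distribution_step c (V s) (p s) @[s --> F] --> distribution_step c V0 p0.
Proof.
apply: cvg_mx => i j; rewrite mxE; under eq_fun do rewrite mxE.
apply: cvg_sum => k; apply: cvgM; apply: cvg_coord => //.
exact: cvg_the_nash_minimizer.
Qed.

End MinimizerLimits.

Lemma simplex_distribution_step p V :
  simplex p -> simplex (distribution_step c V p).
Proof.
move=> hp; have [hP _] := the_nash_minimizerP V hp.
have P0 i j : 0 <= the_nash_minimizer c p V i j.
  by have := (hP i).1 j; rewrite mxE.
split=> [j|]; first by rewrite mxE sumr_ge0 // => k _; rewrite mulr_ge0 // hp.1.
under eq_bigr do rewrite mxE.
rewrite exchange_big /= -hp.2; apply: eq_bigr => k _.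
rewrite -mulr_sumr -[RHS]mulr1; congr (_ * _).
by rewrite -[RHS](hP k).2; apply: eq_bigr => j _; rewrite mxE.
Qed.
End NashMinimizer.

(** * The fixed point map of the game *)

(* The denominator is at least [1], so this is continuous on the whole space. *)
Definition retract_simplex (R : realType) (d : nat) (y : 'rV[R]_d) : 'rV[R]_d :=
  \row_j ((`|y 0 j| + `|1 - \sum_k `|y 0 k| | / d%:R) /
          (\sum_k `|y 0 k| + `|1 - \sum_k `|y 0 k| |)).

Section RetractSimplex.
Variables (R : realType) (d : nat).
Implicit Types y : 'rV[R]_d.

Lemma retract_simplex_denom y :
  0 < \sum_k `|y 0 k| + `|1 - \sum_k `|y 0 k| |.
Proof. by apply: lt_le_trans ltr01 _; rewrite -lerBlDl ler_norm. Qed.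

Lemma simplex_retract_simplex y : (0 < d)%N -> simplex (retract_simplex y).
Proof.
move=> d0; have den := retract_simplex_denom y; split=> [j|].
  by rewrite mxE divr_ge0 ?(ltW den) // addr_ge0 // divr_ge0.
under eq_bigr do rewrite mxE.
rewrite -mulr_suml big_split /= sumr_const card_ord -[X in _ + X]mulr_natr divfK.
  by rewrite divff // gt_eqF.
by rewrite pnatr_eq0 -lt0n.
Qed.

Lemma retract_simplex_id y : simplex y -> retract_simplex y = y.
Proof.
move=> [y0 y1]; apply/rowP => j; rewrite mxE.
have -> : \sum_k `|y 0 k| = 1.
  by rewrite -y1; apply: eq_bigr => k _; rewrite ger0_norm.
by rewrite subrr normr0 mul0r !addr0 divr1 ger0_norm.
Qed.

Lemma cvg_retract_simplex (S : Type) (F : set_system S) {FF : Filter F}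
    (f : S -> 'rV[R]_d) y :
  f @ F --> y -> retract_simplex (f s) @[s --> F] --> retract_simplex y.
Proof.
move=> fy; apply: cvg_mx => i j; rewrite mxE; under eq_fun do rewrite mxE.
have cj k : `|f s 0 k| @[s --> F] --> `|y 0 k|.
  by apply: cvg_norm; exact: cvg_coord.
have cs : \sum_k `|f s 0 k| @[s --> F] --> \sum_k `|y 0 k|.
  exact: cvg_sum.
have cn : `|1 - \sum_k `|f s 0 k| | @[s --> F] --> `|1 - \sum_k `|y 0 k| |.
  by apply: cvg_norm; apply: cvgB => //; exact: cvg_cst.
apply: cvgM.
  by apply: cvgD => //; apply: cvgM => //; exact: cvg_cst.
apply: cvgV; first by rewrite gt_eqF // retract_simplex_denom.
exact: cvgD.
Qed.

End RetractSimplex.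

Lemma sum_mxvec (R : realType) m n (A : 'M[R]_(m, n)) :
  \sum_k mxvec A 0 k = \sum_i \sum_j A i j.
Proof.
rewrite pair_bigA (reindex _ (curry_mxvec_bij m n)) /=.
by apply: eq_bigr => -[i j] _; rewrite mxvecE.
Qed.

Section MeanFieldGame.
Variables (R : realType) (d N : nat) (c : transition_costs R d).
Variables (p0 : 'rV[R]_d) (VN : 'cV[R]_d).
Hypothesis d_gt0 : (0 < d)%N.
Hypothesis simplex_p0 : simplex p0.
Hypothesis uniq_nash : forall (p : 'rV[R]_d) (V : 'cV[R]_d), simplex p ->
  exists! P : 'M[R]_d, nash_minimizer c p V P.
Hypothesis cost_continuous : forall i : 'I_d,
  {within @simplex R d `*` @stochastic R d `*` [set: 'cV[R]_d],
   continuous (fun x : 'rV[R]_d * 'M[R]_d * 'cV[R]_d =>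
     expected_cost c i x.1.1 x.1.2 x.2)}.

(* A point of the simplex with [N.+1 * d] coordinates encodes the distributions
   at times [1, ..., N.+1], each with total mass [N.+1^-1]. *)
Definition decode (x : 'rV[R]_(N.+1 * d)) (n : nat) : 'rV[R]_d :=
  if n is n'.+1 then
    retract_simplex (N.+1%:R *: row (inord n') (vec_mx x))
  else p0.

(** Here [k] counts steps back from the terminal time: this is the value at time [N.+1 - k]. *)
Fixpoint backward_value (x : 'rV[R]_(N.+1 * d)) (k : nat) : 'cV[R]_d :=
  if k is k'.+1 then
    value_step c (decode x (N.+1 - k)) (backward_value x k')
  else VN.

(** Row [k] is the distribution at time [k.+1]; [N - k] backward steps give the value at time
    [k.+1], which the step from time [k] requires. *)
Definition update (x : 'rV[R]_(N.+1 * d)) : 'rV[R]_(N.+1 * d) :=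
  mxvec (\matrix_(k < N.+1) (N.+1%:R^-1 *:
    distribution_step c (backward_value x (N - k)) (decode x k))).

(** The blocks of a point of the large simplex may have unequal masses; the retraction makes each a
    distribution, for any [x]. *)
Lemma simplex_decode x n : simplex (decode x n).
Proof. by case: n => [|n] //=; exact: simplex_retract_simplex. Qed.

Lemma continuous_decode n : continuous (decode^~ n).
Proof.
move=> x; case: n => [|n]; first exact: (@cst_continuous _ _ p0).
apply: (cvg_retract_simplex (F := nbhs x)); apply: (cvg_mx (F := nbhs x)) => i j.
rewrite !mxE; under eq_fun do rewrite !mxE.
by apply: cvgM; [exact: cvg_cst|exact: coord_continuous].
Qed.

Lemma continuous_backward_value k : continuous (backward_value^~ k).
Proof.
elim: k => [|k IH] x; first exact: (@cst_continuous _ _ VN).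
apply: (cvg_value_step uniq_nash cost_continuous (F := nbhs x)) => //.
- exact: simplex_decode.
- by apply: nearW => y; exact: simplex_decode.
- exact: continuous_decode.
- exact: IH.
Qed.

Lemma continuous_update : continuous update.
Proof.
move=> x; apply: (cvg_mx (F := nbhs x)) => i k; rewrite (ord1 i) {i}.
case/mxvec_indexP: k => k j; rewrite mxvecE mxE mxE.
under eq_fun do rewrite mxvecE mxE mxE.
apply: cvgM; first exact: cvg_cst.
apply: (cvg_coord (F := nbhs x)); apply: (cvg_distribution_step uniq_nash cost_continuous (F := nbhs x)) => //.
- exact: simplex_decode.
- by apply: nearW => y; exact: simplex_decode.
- exact: continuous_decode.
- exact: continuous_backward_value.
Qed.

Lemma simplex_update x : simplex (update x).
Proof.
have hs k : simplex (distribution_step c (backward_value x (N - k)) (decode x k)).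
  by apply: simplex_distribution_step => //; exact: simplex_decode.
split=> [k|].
  case/mxvec_indexP: k => k j; rewrite mxvecE mxE mxE mulr_ge0 ?invr_ge0 //.
  exact: (hs k).1.
rewrite sum_mxvec (eq_bigr (fun=> N.+1%:R^-1)) => [|k _]; last first.
  by under eq_bigr do rewrite mxE mxE; rewrite -mulr_sumr (hs k).2 mulr1.
by rewrite sumr_const card_ord -[_ *+ _]mulr_natr mulVf // pnatr_eq0.
Qed.

Lemma update_fixpoint_solution x : update x = x ->
  mfg_solution c N.+1 (decode x) (fun n => backward_value x (N.+1 - n)).
Proof.
move=> fx; split=> [n _|n nN]; first exact: simplex_decode.
rewrite subSS; split.
  by rewrite subSn //= subSS subKn.
have hs := simplex_distribution_step uniq_nash (backward_value x (N - n))
  (simplex_decode x n).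
(* The value equations hold by construction. For the distributions, unfold one [x] as [update x]:
   the scalings cancel, and the retraction fixes the result. *)
rewrite /= -{1}fx mxvecK -[RHS](retract_simplex_id hs); congr retract_simplex.
by apply/rowP => j; rewrite !mxE inordK // mulrA divff ?mul1r ?pnatr_eq0.
Qed.

Lemma mfg_solution_exists : exists (p : nat -> 'rV[R]_d) (V : nat -> 'cV[R]_d),
  [/\ mfg_solution c N.+1 p V, p 0%N = p0 & V N.+1 = VN].
Proof.
have [|||x _ fx] := @brouwer_simplex R (N.+1 * d) update.
- by rewrite muln_gt0.
- exact: continuous_subspaceT continuous_update.
- by move=> x _; exact: simplex_update.
exists (decode x), (fun n => backward_value x (N.+1 - n)); split=> //.
  exact: update_fixpoint_solution.
by rewrite subnn.
Qed.

End MeanFieldGame.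

Theorem theorem5 (R : realType) (d : nat) (hd : (1 < d)%N)
    (c : transition_costs R d)
    (huniq : forall (p : 'rV[R]_d) (V : 'cV[R]_d), simplex p ->
       exists! P : 'M[R]_d, nash_minimizer c p V P)
    (hcont : forall i : 'I_d,
       {within @simplex R d `*` @stochastic R d `*` [set: 'cV[R]_d],
        continuous (fun x : 'rV[R]_d * 'M[R]_d * 'cV[R]_d =>
          expected_cost c i x.1.1 x.1.2 x.2)})
    (N : nat) (hN : (1 <= N)%N)
    (p0 : 'rV[R]_d) (hp0 : simplex p0) (VN : 'cV[R]_d) :
  exists (p : nat -> 'rV[R]_d) (V : nat -> 'cV[R]_d),
    [/\ mfg_solution c N p V, p 0%N = p0 & V N = VN].
Proof.
case: N hN => // N _; apply: mfg_solution_exists => //.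
exact: ltnW.
Qed.
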